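(* Let $W_{\boldsymbol\lambda}$ be a conditionally positive definite (CPD) unilateral weighted shift with weights $\boldsymbol\lambda=\{\lambda_k\}_{k=0}^\infty$, let $(b,c,\nu)$ be its scalar representing triplet and let $(B,C,F)$ be the representing triplet of the operator $W_{\boldsymbol\lambda}$. Suppose that $\sup\mathrm{supp}(\nu)\leq1$ (with $\sup\emptyset=-\infty$), $c=0$, $\int_{\mathbb{R}_+}\frac{1}{1-x}\,d\nu(x)<\infty$ and $b+\int_{\mathbb{R}_+}\frac{1}{1-x}\,d\nu(x)\neq0$. Then $B$ is compact and $W_{\boldsymbol\lambda}$ is not subnormal.
   Context: $\mathbb{Z}_+=\{0,1,2,\dots\}$, $\mathbb{R}_+=[0,\infty)$; scalar measures are positive; $\mathrm{supp}$ denotes closed support. The polynomials $Q_n$ are $Q_0=Q_1=0$ and $Q_n(x)=\sum_{j=0}^{n-2}(n-j-1)x^j$ for $n\geq 2$. A real sequence $\{\gamma_n\}_{n=0}^\infty$ is CPD if $\sum_{i,j=0}^k \gamma_{i+j}\alpha_i\bar\alpha_j\geq 0$ for every finite sequence $\alpha_0,\dots,\alpha_k\in\mathbb{C}$ with $\sum_{j=0}^k\alpha_j=0$. A bounded operator $T$ on a complex Hilbert space $\mathcal{H}$ is CPD if $\{\|T^nh\|^2\}_{n=0}^\infty$ is CPD for every $h\in\mathcal{H}$. A semispectral measure on $\mathbb{R}_+$ is a map $F$ from the Borel $\sigma$-algebra of $\mathbb{R}_+$ to the bounded operators on $\mathcal{H}$ such that $\langle F(\cdot)h,h\rangle$ is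 a (positive) measure for every $h\in\mathcal{H}$. It is known that $T$ is CPD if and only if there are bounded operators $B=B^*$, $C\geq0$ and a compactly supported semispectral measure $F$ on $\mathbb{R}_+$ with $F(\{1\})=0$ such that $T^{*n}T^n=I+nB+n^2C+\int_{\mathbb{R}_+}Q_n(x)\,F(dx)$ for all $n\in\mathbb{Z}_+$; the triplet $(B,C,F)$ is then unique and is called the representing triplet of $T$. For a bounded sequence $\boldsymbol\lambda$ of positive reals, $W_{\boldsymbol\lambda}$ is the bounded operator on $\ell^2$ with $W_{\boldsymbol\lambda}e_n=\lambda_ne_{n+1}$ ($\{e_n\}$ the standard orthonormal basis); $\hat\lambda_0=1$ and $\hat\lambda_n=\lambda_0^2\cdots\lambda_{n-1}^2$ for $n\geq1$. If $W_{\boldsymbol\lambda}$ is CPD, its scalar representing triplet is the unique $(b,c,\nu)$ with $b\in\mathbb{R}$, $c\in\mathbb{R}_+$, $\nu$ a compactly supported finite Borel measure on $\mathbb{R}_+$ with $\nu(\{1\})=0$ and $\hat\lambda_n=1+bn+cn^2+\int_{\mathbb{R}_+}Q_n\,d\nu$ for all $n\in\mathbb{Z}_+$. *)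

(* Defs.v *)
From HB Require Import structures.
From mathcomp Require Import all_boot all_order all_algebra.
From mathcomp Require Import all_classical all_reals all_analysis.
From mathcomp Require Import complex sesquilinear ring lra.

Set Implicit Arguments.
Unset Strict Implicit.
Unset Printing Implicit Defensive.

Import Order.TTheory GRing.Theory Num.Theory.
Import numFieldNormedType.Exports numFieldTopology.Exports.

Local Open Scope classical_set_scope.
Local Open Scope ring_scope.

(* A complex Hilbert space: a complete normed space over R[i] whose norm comes
   from a Hermitian inner product, linear in its first argument. *)
HB.mixin Record NormedModule_isHilbert (R : realType) H
    & CompleteNormedModule R[i] H := {
  inner : {dot H for (@Num.conj R[i])};
  innerE : forall x : H, inner x x = `|x| ^+ 2
}.

#[short(type="hilbertType")]
HB.structure Definition Hilbert (R : realType) :=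
  {H of CompleteNormedModule R[i] H & NormedModule_isHilbert R H}.

Section SquareSummable.
Variable R : realType.
Local Notation C := R[i].
Implicit Types (z : C) (u v x y : nat -> C) (a : nat -> R).

Definition normc2 z : R := complex.Re z ^+ 2 + complex.Im z ^+ 2.

Definition square_summable x : Prop := cvgn (series (fun k => normc2 (x k))).

Lemma normc2_ge0 z : 0 <= normc2 z.
Proof. by rewrite addr_ge0 ?sqr_ge0. Qed.

Lemma normc2E z : (normc2 z)%:C%C = `|z| ^+ 2.
Proof. exact: add_Re2_Im2. Qed.

Lemma normc2M z w : normc2 (z * w) = normc2 z * normc2 w.
Proof. by case: z w => [a b] [c d]; rewrite /normc2 /=; ring. Qed.

Lemma normc2D z w : normc2 (z + w) <= 2 * normc2 z + 2 * normc2 w.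
Proof.
case: z w => [a b] [c d]; rewrite /normc2 /=.
rewrite -subr_ge0 [X in 0 <= X](_ : _ = (a - c) ^+ 2 + (b - d) ^+ 2); last by ring.
by rewrite addr_ge0 ?sqr_ge0.
Qed.

Lemma nneg_series_bounded a : (forall k, 0 <= a k) ->
  cvgn (series a) <-> exists M, forall n, \sum_(k < n) a k <= M.
Proof.
move=> a0; split=> [|[M aM]].
  move=> /cvg_seq_bounded/bounded_fun_has_ubound[M aM]; exists M => n.
  by apply: aM; exists n => //; rewrite /series /= big_mkord.
apply: nondecreasing_is_cvgn; first exact: nondecreasing_series.
by exists M => _ [n _ <-]; rewrite /series /= big_mkord.
Qed.

Lemma nneg_series_le a n : (forall k, 0 <= a k) -> cvgn (series a) ->
  \sum_(k < n) a k <= limn (series a).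
Proof.
move=> a0 ca; have := nondecreasing_cvgn_le (nondecreasing_series (P := xpredT) (m:=0%N) _) ca n.
by rewrite /series /= big_mkord; apply.
Qed.

Lemma series_le_norm a b : (forall k, 0 <= b k) -> (forall k, `|a k| <= b k) ->
  cvgn (series b) -> cvgn (series a).
Proof.
by move=> b0 ab cb; apply: (@normed_cvg _ R^o); apply: series_le_cvg cb => // n; exact: normr_ge0.
Qed.

Lemma square_summable0 : square_summable 0.
Proof.
apply/nneg_series_bounded => [k|]; first exact: normc2_ge0.
by exists 0 => n; rewrite big1// => k _; rewrite /normc2 /= expr0n addr0.
Qed.

Lemma square_summableZD c x y : square_summable x -> square_summable y ->
  square_summable (c *: x + y).
Proof.
move=> /nneg_series_bounded-/(_ (fun=> normc2_ge0 _))[M xM].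
move=> /nneg_series_bounded-/(_ (fun=> normc2_ge0 _))[N yN].
apply/nneg_series_bounded => [k|]; first exact: normc2_ge0.
exists (2 * normc2 c * M + 2 * N) => n.
apply: (@le_trans _ _ (\sum_(k < n) (2 * normc2 c * normc2 (x k) + 2 * normc2 (y k)))).
  by apply: ler_sum => k _; rewrite -mulrA -normc2M; apply: normc2D.
rewrite big_split /= -!mulr_sumr.
by apply: lerD; apply: ler_wpM2l; rewrite ?mulr_ge0 ?normc2_ge0 ?xM ?yN.
Qed.

Definition csum u : C :=
  (limn (series (fun k => complex.Re (u k))) +i* limn (series (fun k => complex.Im (u k))))%C.

Definition csummable u : Prop :=
  cvgn (series (fun k => complex.Re (u k))) /\ cvgn (series (fun k => complex.Im (u k))).

Lemma csumZD c u v : csummable u -> csummable v ->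
  csum (fun k => c * u k + v k) = c * csum u + csum v.
Proof.
case: c => [a b] [uR uI] [vR vI]; rewrite /csum.
have -> : (fun k => complex.Re ((a +i* b)%C * u k + v k)) =
    a *: (fun k => complex.Re (u k)) +
    ((- b) *: (fun k => complex.Im (u k)) + (fun k => complex.Re (v k))).
  apply/funext => k; rewrite !fctE /=.
  by case: (u k) (v k) => [? ?] [? ?] /=; rewrite addrA scaleNr.
have -> : (fun k => complex.Im ((a +i* b)%C * u k + v k)) =
    a *: (fun k => complex.Im (u k)) +
    (b *: (fun k => complex.Re (u k)) + (fun k => complex.Im (v k))).
  apply/funext => k; rewrite !fctE /=.
  by case: (u k) (v k) => [? ?] [? ?] /=; rewrite addrA.
have limE (f g h : R ^nat) r s : cvgn (series f) -> cvgn (series g) ->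
    cvgn (series h) -> limn (series (r *: f + (s *: g + h))) =
    r * limn (series f) + (s * limn (series g) + limn (series h)).
  move=> cf cg ch; have crf := is_cvg_seriesZ (k := r) cf.
  have csg := is_cvg_seriesZ (k := s) cg.
  rewrite lim_seriesD//; last exact: is_cvg_seriesD.
  by rewrite lim_seriesD// !lim_seriesZ.
by rewrite !limE//; simpc; rewrite !addrA.
Qed.

Lemma csummable_conj x y : square_summable x -> square_summable y ->
  csummable (fun k => x k * (y k)^*).
Proof.
move=> xs ys; have := is_cvg_seriesD xs ys.
have s0 k : 0 <= normc2 (x k) + normc2 (y k) by rewrite addr_ge0 ?normc2_ge0.
split; apply: series_le_norm s0 _ _ => //= k;
  case: (x k) (y k) => [a b] [c d]; rewrite /normc2 /= ler_norml.
- rewrite !mulrN opprK.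
  have := sqr_ge0 (a + c); have := sqr_ge0 (b + d).
  have := sqr_ge0 (a - c); have := sqr_ge0 (b - d).
  have := sqr_ge0 a; have := sqr_ge0 b; have := sqr_ge0 c; have := sqr_ge0 d.
  nra.
- have := sqr_ge0 (a + d); have := sqr_ge0 (b + c).
  have := sqr_ge0 (a - d); have := sqr_ge0 (b - c).
  have := sqr_ge0 a; have := sqr_ge0 b; have := sqr_ge0 c; have := sqr_ge0 d.
  nra.
Qed.

End SquareSummable.

Section CauchySchwarz.
Variables (C : numClosedFieldType) (U : lmodType C) (f : {dot U for (@Num.conj C)}).

Lemma dot_CauchySchwarz u v : `|f u v| ^+ 2 <= f u u * f v v.
Proof.
have [->|v0] := eqVneq v 0.
  by rewrite !linear0r normr0 expr0n.
have fv0 : f v v != 0 by rewrite dnorm_eq0.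
pose a := f u v / f v v; pose w := u - a *: v.
have wv : f w v = 0 by rewrite /w linearBl/= linearZl_LR divfK// subrr.
have -> : u = w + a *: v by rewrite subrK.
rewrite linearDl/= wv add0r linearZl_LR/= hnormDd/=; last first.
  by rewrite linearZr_LR/= wv mulr0.
rewrite dnormZ normrM (ger0_norm (dnorm_ge0 _ _)) exprMn mulrDl.
by rewrite [X in X <= _ + _](_ : _ = `|a| ^+ 2 * f v v * f v v) ?lerDr ?mulr_ge0// expr2 mulrA.
Qed.

Lemma dot_triangle u v : sqrtC (f (u + v) (u + v)) <= sqrtC (f u u) + sqrtC (f v v).
Proof.
have s0 w : 0 <= sqrtC (f w w) by exact: sqrt_dnorm_ge0.
rewrite -(@ler_pXn2r _ 2)// ?nnegrE ?addr_ge0//.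
rewrite sqrrD !sqrtCK addrAC dnormD lerD2l.
rewrite -mulr_natr -[_ + _](divfK (negbT (pnatr_eq0 C 2))) -/('Re _).
rewrite ler_pM2r ?ltr0n// -ReE (le_trans (leif_Re_Creal _))//.
rewrite -(@ler_pXn2r _ 2)// ?nnegrE ?mulr_ge0//.
by rewrite exprMn !sqrtCK dot_CauchySchwarz.
Qed.

End CauchySchwarz.

Section Ell2.
Variable R : realType.
Local Notation C := R[i].

(* The Hilbert space of square-summable complex sequences indexed by nat. *)
Definition ell2_pred : {pred nat -> C} := fun x => `[< square_summable x >].

Lemma ell2_pred_submod : submod_closed ell2_pred.
Proof.
split=> [|c x y]; rewrite !unfold_in.
  exact/asboolT/square_summable0.
move=> xs ys; apply/asboolT.
exact: square_summableZD (asboolW xs) (asboolW ys).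
Qed.

HB.instance Definition _ :=
  GRing.isSubmodClosed.Build C (nat -> C) ell2_pred ell2_pred_submod.

Record ell2 := Ell2 { ell2_val :> nat -> C; _ : ell2_val \in ell2_pred }.

HB.instance Definition _ := [isSub for ell2_val].
HB.instance Definition _ := [Choice of ell2 by <:].
HB.instance Definition _ := [SubChoice_isSubLmodule of ell2 by <:].
Implicit Types x y z : ell2.

Lemma ell2P x : square_summable x.
Proof. by case: x => x /= /asboolP. Qed.

Arguments ell2P : clear implicits.

Definition ell2_dot x y : C := csum (fun k => x k * (y k)^*).

Lemma ell2_dot_bilinear : bilinear_for *%R (@Num.conj C \; *%R) ell2_dot.
Proof.
split=> z c x y; rewrite /ell2_dot.
  rewrite -csumZD; try exact: csummable_conj (ell2P _) (ell2P _).
  congr csum; apply/funext => k.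
  by rewrite /= mulrDl mulrA.
have sP (w : ell2) : csummable (fun k => z k * (w k)^*) .
  exact: csummable_conj (ell2P z) (ell2P w).
rewrite -[RHS]/(c^* * csum (fun k => z k * (x k)^*) + csum (fun k => z k * (y k)^*)).
rewrite -csumZD//; congr csum; apply/funext => k.
by rewrite /= rmorphD rmorphM /= mulrDr mulrCA.
Qed.

HB.instance Definition _ := bilinear_isBilinear.Build C ell2 ell2 C
  *%R (@Num.conj C \; *%R) ell2_dot ell2_dot_bilinear.

Lemma ell2_dot_herm x y : ell2_dot x y = (-1) ^+ false * (ell2_dot y x)^*.
Proof.
rewrite expr0 mul1r; have [_ cI] := csummable_conj (ell2P y) (ell2P x).
rewrite -[RHS]/(conjc (csum _)) /csum [RHS]/= -lim_seriesN//; congr (_ +i* _)%C.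
  congr (limn (series _)); apply/funext => k.
  by case: (x k) (y k) => [a b] [c d] /=; rewrite !mulrN !opprK [c * a]mulrC [d * b]mulrC.
congr (limn (series _)); apply/funext => k; rewrite fctE.
by case: (x k) (y k) => [a b] [c d] /=; ring.
Qed.

HB.instance Definition _ := isHermitianSesquilinear.Build C ell2 false
  (@Num.conj C) ell2_dot ell2_dot_herm.

Lemma ell2_dotE x :
  ell2_dot x x = (limn (series (fun k => normc2 (x k))))%:C%C.
Proof.
rewrite /ell2_dot /csum; congr (_ +i* _)%C.
  congr (limn (series _)); apply/funext => k.
  by case: (x k) => [a b] /=; rewrite /normc2 /= mulrN opprK.
rewrite [X in series X](_ : _ = 0); last first.
  by apply/funext => k; case: (x k) => [a b] /=; rewrite mulrN mulrC addNr.
rewrite [series _](_ : _ = fun=> 0) ?lim_cst//.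
by apply/funext => n; rewrite /series /= big1.
Qed.

Lemma ell2_partial_le x n :
  \sum_(k < n) normc2 (x k) <= limn (series (fun k => normc2 (x k))).
Proof. exact: nneg_series_le (fun=> normc2_ge0 _) (ell2P x). Qed.

Lemma ell2_dot_gt0 x : x != 0 -> 0 < ell2_dot x x.
Proof.
move=> x0; rewrite ell2_dotE ltcR lt_neqAle; apply/andP; split; last first.
  by have := ell2_partial_le x 0; rewrite big_ord0.
apply: contra x0 => /eqP lim0; apply/eqP/val_inj/funext => k /=.
have := ell2_partial_le x k.+1; rewrite -lim0 big_ord_recr /= => le0.
have {le0} : normc2 (x k) <= 0.
  by apply: le_trans le0; rewrite lerDr sumr_ge0// => i _; exact: normc2_ge0.
case: (x k) => a b; rewrite /normc2 /= => ab0.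
have /eqP : a ^+ 2 + b ^+ 2 = 0.
  by apply/eqP; rewrite eq_le ab0 addr_ge0 ?sqr_ge0.
by rewrite paddr_eq0 ?sqr_ge0// !sqrf_eq0 => /andP[/eqP -> /eqP ->].
Qed.

HB.instance Definition _ := isDotProduct.Build C ell2 ell2_dot ell2_dot_gt0.

Let dot : {dot ell2 for (@Num.conj C)} := ell2_dot.

Definition ell2_norm x : C := sqrtC (ell2_dot x x).

Lemma ell2_ler_normD x y : ell2_norm (x + y) <= ell2_norm x + ell2_norm y.
Proof. exact: (dot_triangle dot). Qed.

Lemma ell2_normrZ (c : C) x : ell2_norm (c *: x) = `|c| * ell2_norm x.
Proof.
by rewrite /ell2_norm (dnormZ dot) sqrtCM ?nnegrE ?(dnorm_ge0 dot)// sqrCK.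
Qed.

Lemma ell2_normr0_eq0 x : ell2_norm x = 0 -> x = 0.
Proof. by move=> /eqP; rewrite (sqrt_dnorm_eq0 dot) => /eqP. Qed.

HB.instance Definition _ := Lmodule_isNormed.Build C ell2
  ell2_ler_normD ell2_normrZ ell2_normr0_eq0.

Lemma ell2_dot_norm x : ell2_dot x x = `|x| ^+ 2.
Proof. by rewrite -[`|x|]/(ell2_norm x) sqrtCK. Qed.

Lemma ell2_le_norm x (r : R) : 0 <= r ->
  (`|x| <= r%:C%C) = (limn (series (fun k => normc2 (x k))) <= r ^+ 2).
Proof.
move=> r0; rewrite -(@ler_pXn2r _ 2) ?nnegrE ?ler0c// -ell2_dot_norm ell2_dotE.
by rewrite -rmorphXn /= lecR.
Qed.

Lemma normc2_le_ell2_norm x k (r : R) : 0 <= r -> `|x| <= r%:C%C ->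
  normc2 (x k) <= r ^+ 2.
Proof.
move=> r0; rewrite ell2_le_norm// => /(le_trans (ell2_partial_le x k.+1)).
apply: le_trans; rewrite big_ord_recr/= lerDr sumr_ge0// => i _.
exact: normc2_ge0.
Qed.

Lemma ell2_complete (F : set_system ell2) :
  ProperFilter F -> cauchy F -> cvg F.
Proof.
move=> FF /cauchyP Fc.
have gt0_real (e : C) : 0 < e -> exists2 r : R, 0 < r & e = r%:C%C.
  by case: e => a b; rewrite ltcE /= => /andP[/eqP -> a0]; exists a.
have Fball (r : R) : 0 < r -> exists z, F [set y | `|z - y| <= r%:C%C].
  move=> r0; have [|z zF] := Fc r%:C%C; first by rewrite ltcR.
  by exists z; apply: filterS zF => y; rewrite -ball_normE /= => /ltW.
have coordE z y k : (z - y) k = z k - y k by [].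
have coord_cvg (p : C -> R) : (forall c d : C, p (c - d) = p c - p d) ->
    (forall c, p c ^+ 2 <= normc2 c) -> forall k,
    cvg ((fun y : ell2 => p (y k)) @ F).
  move=> pB pn k; apply: R_complete; apply: cauchy_exP => e e0.
  have [z zF] := Fball (e / 2) (divr_gt0 e0 (ltr0n _ 2)).
  exists (p (z k)); apply: (@filterS _ F _ _ _ _ zF) => y /= zy.
  rewrite -ball_normE /=.
  rewrite -[X in `|X|]/(p (z k) - p (y k)) -pB -coordE.
  apply: (@le_lt_trans _ _ (e / 2)); last by lra.
  have e2 : 0 <= e / 2 by lra.
  rewrite -(@ler_pXn2r _ 2)// ?nnegrE// -normrX ger0_norm ?sqr_ge0//.
  exact/(le_trans (pn _))/normc2_le_ell2_norm.
have cRe : forall k, cvg ((fun y : ell2 => complex.Re (y k)) @ F).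
  by apply: coord_cvg => [[? ?] [? ?]//|[a b]]; rewrite /normc2 /= lerDl sqr_ge0.
have cIm : forall k, cvg ((fun y : ell2 => complex.Im (y k)) @ F).
  by apply: coord_cvg => [[? ?] [? ?]//|[a b]]; rewrite /normc2 /= lerDr sqr_ge0.
pose a k : C := (lim ((fun y : ell2 => complex.Re (y k)) @ F) +i*
                 lim ((fun y : ell2 => complex.Im (y k)) @ F))%C.
have cnorm z k : (fun y : ell2 => normc2 (z k - y k)) @ F --> normc2 (z k - a k).
  have normc2B (c d : C) : normc2 (c - d) =
      (complex.Re c - complex.Re d) * (complex.Re c - complex.Re d) +
      (complex.Im c - complex.Im d) * (complex.Im c - complex.Im d).
    by case: c d => [? ?] [? ?]; rewrite /normc2 /= !expr2.
  under eq_fun do rewrite normc2B.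
  rewrite normc2B /a /=.
  by apply: cvgD; apply: cvgM; apply: cvgB; do ?[exact: cvg_cst|exact: cRe|exact: cIm].
have csumn z n : (fun y : ell2 => \sum_(k < n) normc2 (z k - y k)) @ F -->
    \sum_(k < n) normc2 (z k - a k).
  by apply: cvg_big => [|i _]; [exact: add_continuous|exact: cnorm].
have Fa (r : R) : 0 < r -> exists2 A, F A & forall y, A y -> forall n,
    \sum_(k < n) normc2 (y k - a k) <= r ^+ 2.
  move=> r0; have [z zF] := Fball (r / 2) (divr_gt0 r0 (ltr0n _ 2)).
  eexists; first exact: zF.
  move=> y /= zy n; rewrite -(cvg_lim _ (csumn y n))//.
  apply: limr_le; first by apply/cvg_ex; eexists; exact: csumn.
  apply: filterS zF => w /= zw.
  have yw : `|y - w| <= r%:C%C.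
    rewrite -(subrK z y) -addrA (le_trans (ler_normD _ _))// distrC.
    rewrite [r](_ : _ = r / 2 + r / 2) ?rmorphD /= ?lerD//; lra.
  move: yw; rewrite (ell2_le_norm _ (ltW r0)) => /(le_trans _); apply.
  exact: ell2_partial_le (y - w) n.
have a_ss : square_summable a.
  have [A FA Ale] := Fa 1 ltr01.
  have [y Ay] := filter_ex FA.
  have -> : a = (-1) *: (fun k => y k - a k) + (y : nat -> C).
    by apply/funext => k; rewrite !fctE scaleN1r opprB subrK.
  apply: square_summableZD; last exact: ell2P.
  by apply/nneg_series_bounded => [k|]; [exact: normc2_ge0|exists (1 ^+ 2); exact: Ale].
apply/cvg_ex; exists (Ell2 (asboolT a_ss)); apply/cvgrPdist_le => e e0.
have [r r0 ->] := gt0_real e e0; have [A FA Ale] := Fa r r0.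
apply: filterS FA => y Ay; rewrite distrC (ell2_le_norm _ (ltW r0)).
apply: limr_le; first exact: (ell2P (y - Ell2 (asboolT a_ss))).
by near=> n; rewrite /series /= big_mkord; exact: Ale.
Unshelve. all: by end_near.
Qed.

HB.instance Definition _ := Uniform_isComplete.Build ell2 ell2_complete.
HB.instance Definition _ := NormedModule_isHilbert.Build R ell2 ell2_dot_norm.

End Ell2.

Section WeightedShift.
Variables (R : realType) (lam : nat -> R).
Local Notation C := R[i].

Lemma ell2_basis_subproof n : square_summable (fun k => (k == n)%:R : C).
Proof.
apply/nneg_series_bounded => [k|]; first exact: normc2_ge0.
exists 1 => m; apply: (@le_trans _ _ (\sum_(k < m) (nat_of_ord k == n)%:R)).
  apply: ler_sum => k _; rewrite /normc2.
  by case: (_ == n) => /=; rewrite ?expr1n expr0n/= addr0.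
rewrite -natr_sum lern1.
have [nm|mn] := ltnP n m; last first.
  rewrite big1// => k _; apply/eqP; rewrite eqb0 neq_ltn.
  by rewrite (leq_trans (ltn_ord k) mn).
rewrite (bigD1 (Ordinal nm))//= eqxx big1// => k kn.
by apply/eqP; rewrite eqb0; apply: contra kn => /eqP kn; apply/eqP/val_inj.
Qed.
Arguments ell2_basis_subproof : clear implicits.

Definition ell2_basis n : ell2 R := Ell2 (asboolT (ell2_basis_subproof n)).

Hypothesis lam_bnd : bounded_fun lam.

Definition wshift_seq (x : nat -> C) (k : nat) : C :=
  if k is k'.+1 then (lam k')%:C%C * x k' else 0.

Lemma wshift_bound : exists2 M : R, 0 <= M &
  forall x n, \sum_(k < n) normc2 (wshift_seq x k) <=
              M ^+ 2 * \sum_(k < n) normc2 (x k).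
Proof.
have [M M0 lamM] := pinfty_ex_gt0 lam_bnd.
exists M => [|x n]; first exact: ltW.
case: n => [|n]; first by rewrite !big_ord0 mulr0.
rewrite big_ord_recl /= {1}/normc2 /= expr0n /= addr0 add0r.
rewrite big_ord_recr /= mulrDr ler_wpDr ?mulr_ge0 ?sqr_ge0 ?normc2_ge0 ?(ltW M0)//.
rewrite mulr_sumr; apply: ler_sum => k _.
rewrite add0n.
have -> : normc2 ((lam k)%:C%C * x k) = lam k ^+ 2 * normc2 (x k).
  by case: (x k) => a b; rewrite /normc2 /=; ring.
rewrite ler_wpM2r ?normc2_ge0// -(real_normK (num_real (lam k))).
by rewrite ler_pXn2r ?nnegrE ?(ltW M0)//; exact: lamM.
Qed.

Lemma wshift_subproof (x : ell2 R) : square_summable (wshift_seq x).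
Proof.
have [M M0 Mle] := wshift_bound.
apply/nneg_series_bounded => [k|]; first exact: normc2_ge0.
exists (M ^+ 2 * limn (series (fun k => normc2 (x k)))) => n.
by rewrite (le_trans (Mle _ _))// ler_wpM2l ?sqr_ge0// ell2_partial_le.
Qed.

Arguments wshift_subproof : clear implicits.

Definition wshift (x : ell2 R) : ell2 R := Ell2 (asboolT (wshift_subproof x)).

Lemma wshift_linear : linear wshift.
Proof.
move=> c x y; apply/val_inj/funext => -[|k] /=.
  by rewrite !fctE /= scaler0 addr0.
rewrite -[LHS]/((lam k)%:C%C * (c * x k + y k)).
by rewrite mulrDr mulrCA.
Qed.

HB.instance Definition _ :=
  GRing.isLinear.Build C (ell2 R) (ell2 R) *:%R wshift wshift_linear.

Lemma wshift_basis n : wshift (ell2_basis n) = (lam n)%:C%C *: ell2_basis n.+1.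
Proof.
apply/val_inj/funext => -[|k] /=; rewrite !fctE /=; first by rewrite scaler0.
rewrite eqSS; have [->//|_] := eqVneq k n.
by rewrite mulr0 scaler0.
Qed.

End WeightedShift.
Arguments wshift {R lam} lam_bnd x.

Section Definitions.
Variable R : realType.
Local Notation measureR := {finite_measure set (measurableTypeR R) -> \bar R}.

(* Measures on the half-line [0, +oo[ are encoded as Borel measures on the whole
   line that vanish on the complement of Rplus. *)
Definition Rplus : set R := [set x | 0 <= x].

(* The index j ranges over 0 <= j <= n - 2; the sum is empty for n = 0, 1. *)
Definition Qpoly (n : nat) (x : R) : R := \sum_(j < n.-1) (n - j.+1)%:R * x ^+ j.

Definition cpd_seq (g : nat -> R) : Prop :=
  forall (k : nat) (a : 'I_k.+1 -> R[i]), \sum_j a j = 0 ->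
    0 <= \sum_(i < k.+1) \sum_(j < k.+1) (g (i + j)%N)%:C%C * a i * (a j)^*.

(* Closed support of a Borel measure on the line. *)
Definition msupp (mu : set R -> \bar R) : set R :=
  [set x | forall U : set R, open U -> U x -> (0 < mu U)%E].

Section Operators.
Variable H : hilbertType R.
Implicit Types (T S : {linear H -> H}) (F : set R -> {linear H -> H}).

Definition bounded_operator T : Prop :=
  exists M : R, forall h, `|T h| <= M%:C%C * `|h|.

(* S is the adjoint of T. Every bounded operator has a unique adjoint, so
   asserting below that some adjoint with a given property exists says that
   the adjoint has this property. *)
Definition is_adjoint T S : Prop := forall x y, inner (T x) y = inner x (S y).

(* The order of R[i] only relates numbers with equal imaginary parts, so this
   includes that the quadratic form is real, hence that T is self-adjoint. *)
Definition positive_operator T : Prop := forall h, 0 <= inner (T h) h.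

Definition compact_operator T : Prop := precompact (T @` [set h | `|h| <= 1]).

Definition cpd_operator T : Prop :=
  bounded_operator T /\
  forall h, cpd_seq (fun n => complex.Re (`|iter n T h| ^+ 2)).

Definition normal_operator T : Prop :=
  bounded_operator T /\
  exists2 S, is_adjoint T S & forall h, T (S h) = S (T h).

(* mu is the scalar measure <F(.)h, h>. *)
Definition quad_measure F (h : H) (mu : measureR) : Prop :=
  forall A : set (measurableTypeR R), measurable A ->
    inner (F A h) h = (fine (mu A))%:C%C.

Definition semispectral F : Prop :=
  (forall A : set (measurableTypeR R), measurable A -> bounded_operator (F A)) /\
  forall h, exists mu : measureR, quad_measure F h mu.

Definition opsupp F : set R :=
  [set x | forall U : set R, open U -> U x -> exists h, F U h <> 0].

(* S is the weak integral of f against F over the half-line: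
   <S h, h> is the integral of f against <F(.)h, h>. *)
Definition is_opintegral F (f : R -> R) S : Prop :=
  forall h (mu : measureR), quad_measure F h mu ->
    inner (S h) h = (\int[mu]_(x in Rplus) f x)%:C%C.

(* Tadj is the adjoint of T, S the integral of Qpoly n against F, and the last
   clause is the operator identity
   Tadj^n T^n = I + n B + n^2 C + S. *)
Record representing_triplet T (B C : {linear H -> H}) F : Prop := {
  triplet_B : bounded_operator B /\ is_adjoint B B;
  triplet_C : bounded_operator C /\ positive_operator C;
  triplet_F : semispectral F;
  triplet_Rplus : forall h, F (~` Rplus) h = 0;
  triplet_supp : compact (opsupp F);
  triplet_1 : forall h, F [set 1] h = 0;
  triplet_repr : exists2 Tadj : {linear H -> H}, is_adjoint T Tadj &
    forall n, exists S : {linear H -> H},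
      [/\ bounded_operator S, is_opintegral F (Qpoly n) S &
       forall h, iter n Tadj (iter n T h) = h + B h *+ n + C h *+ n ^ 2 + S h]
}.
End Operators.

(* H is identified with a subspace of K by the linear isometry V, whose range is
   then invariant under the normal operator N. *)
Definition subnormal (H : hilbertType R) (T : {linear H -> H}) : Prop :=
  exists (K : hilbertType R) (V : {linear H -> K}) (N : {linear K -> K}),
    [/\ forall x y, inner (V x) (V y) = inner x y,
        normal_operator N &
        forall h, N (V h) = V (T h)].

Record scalar_triplet (lam : nat -> R) (b c : R) (nu : measureR) : Prop := {
  scalar_c : 0 <= c;
  scalar_Rplus : nu (~` Rplus) = 0%E;
  scalar_supp : compact (msupp nu);
  scalar_1 : nu [set 1] = 0%E;
  scalar_repr : forall n, \prod_(k < n) lam k ^+ 2 =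
    1 + b * n%:R + c * n%:R ^+ 2 + \int[nu]_(x in Rplus) Qpoly n x
}.

End Definitions.

Arguments Rplus {R}.

Lemma wshift_bounded (R : realType) (lam : nat -> R)
    (lam_bnd : bounded_fun lam) : bounded_operator (wshift lam_bnd).
Proof.
have [M M0 Mle] := wshift_bound lam_bnd; exists M => x.
rewrite -(@ler_pXn2r _ 2) ?nnegrE ?mulr_ge0 ?ler0c// exprMn.
rewrite -!ell2_dot_norm !ell2_dotE -rmorphXn /= -rmorphM /= lecR.
have cv := @wshift_subproof R lam lam_bnd x.
apply: limr_le; first exact: cv.
near=> n; rewrite /series /= big_mkord (le_trans (Mle _ _))//.
by rewrite ler_wpM2l ?sqr_ge0// ell2_partial_le.
Unshelve. all: by end_near. Qed.

(* Main.v *)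
Require Import Defs.
From mathcomp Require Import all_boot all_order all_algebra.
From mathcomp Require Import all_classical all_reals all_analysis.
From mathcomp Require Import complex sesquilinear measurable_realfun ring lra.

Set Implicit Arguments.
Unset Strict Implicit.
Unset Printing Implicit Defensive.

Import Order.TTheory GRing.Theory Num.Theory.
Import numFieldNormedType.Exports numFieldTopology.Exports.

Local Open Scope classical_set_scope.
Local Open Scope ring_scope.

(** Put m n = lam_0^2 ... lam_(n-1)^2. Since Q_(n+1) - Q_n is the geometric sum
    1 + x + ... + x^(n-1), and nu lives on [0, 1[, the increments of m are
    b + int (1 + x + ... + x^(n-1)) dnu when c = 0. They increase to
    d = b + int 1/(1-x) dnu by monotone convergence (Rintegral_geom_cvg), so m is
    convex and lies below the line 1 + d n. As m is positive, d cannot be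
    negative; hence d > 0, m tends to infinity, and
    lam_n^2 - 1 = (m (n+1) - m n) / m n tends to 0 (convex_ratio_cvg0).

    Compactness of B. The operator D = W^* W - I - B is self-adjoint, and its
    quadratic form is that of C, because the integral of Q_1 = 0 vanishes. On
    basis vectors, ||W^n e_k||^2 = m (k+n) / m k grows at most linearly in n,
    whereas it dominates n^2 <C e_k, e_k> up to a linear term; so
    <D e_k, e_k> = <C e_k, e_k> = 0, and Cauchy-Schwarz for the positive form of
    D gives D e_k = 0 (positive_form_kernel). Hence D = 0, and B = W^* W - I is
    the diagonal operator with entries lam_k^2 - 1 (linear_growth_diagonal).
    These tend to 0, and such an operator is compact (diagonal_compact).

    Failure of subnormality. A subnormal operator satisfies
    ||T x||^4 <= ||x||^2 ||T^2 x||^2 (subnormal_norm_le), so the weights of a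
    subnormal shift are nondecreasing. Their limit being 1, they would be at most
    1, making m nonincreasing; this contradicts d > 0. *)

(** * Convex sequences with convergent increments *)

Section Increments.
Variables (R : realType) (m : R ^nat) (d : R).
Hypothesis m_gt0 : forall n, 0 < m n.
Hypothesis dm_ndecr : {homo (fun n => m n.+1 - m n) : k n / (k <= n)%N >-> k <= n}.
Hypothesis dm_cvg : m n.+1 - m n @[n --> \oo] --> d.

Lemma increment_le_lim n : m n.+1 - m n <= d.
Proof.
rewrite -(cvg_lim _ dm_cvg)//.
exact: (nondecreasing_cvgn_le dm_ndecr (cvgP _ dm_cvg)).
Qed.

Lemma convex_le_chord n : m n <= m 0%N + d * n%:R.
Proof.
elim: n => [|n IHn]; first by rewrite mulr0 addr0.
have := increment_le_lim n; rewrite -natr1 mulrDr mulr1; lra.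
Qed.

(** Convexity turns one positive increment into a linear lower bound; this is
    what makes the sequence unbounded. *)
Lemma convex_ge_tangent N k : m N + (m N.+1 - m N) * k%:R <= m (N + k)%N.
Proof.
elim: k => [|k IHk]; first by rewrite mulr0 addr0 addn0.
have := dm_ndecr (leq_addr k N); rewrite addnS -natr1 mulrDr mulr1; lra.
Qed.

Hypothesis d_neq0 : d != 0.

(** For d < 0 the chord m 0 + d n would eventually be negative. *)
Lemma lim_increment_gt0 : 0 < d.
Proof.
rewrite lt_neqAle eq_sym d_neq0 leNgt /=; apply/negP => d_lt0.
have d0 : 0 < - d by rewrite oppr_gt0.
have := archi_boundP (divr_ge0 (ltW (m_gt0 0)) (ltW d0)).
rewrite ltr_pdivrMr// => m0d.
have := convex_le_chord (Num.bound (m 0%N / - d)).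
have := m_gt0 (Num.bound (m 0%N / - d)); lra.
Qed.

Lemma convex_cvgy : m n @[n --> \oo] --> +oo.
Proof.
have [N _ /(_ N (leqnn N)) /= dN] := cvgr_gt d dm_cvg 0 lim_increment_gt0.
apply/cvgryPge => A; exists (N + Num.bound (`|A| / (m N.+1 - m N)))%N => // n /=.
move=> Nn; have := convex_ge_tangent N (n - N).
rewrite subnKC ?(leq_trans (leq_addr _ _) Nn)//; apply: le_trans.
have A0 : 0 <= `|A| / (m N.+1 - m N) by rewrite divr_ge0// ltW.
have := archi_boundP A0; rewrite ltr_pdivrMr// mulrC => /ltW Abound.
have := m_gt0 N; have := ler_norm A.
suff : (m N.+1 - m N) * (Num.bound (`|A| / (m N.+1 - m N)))%:R <=
  (m N.+1 - m N) * (n - N)%:R by lra.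
by rewrite ler_wpM2l ?(ltW dN)// ler_nat leq_subRL ?(leq_trans (leq_addr _ _) Nn).
Qed.

Lemma convex_ratio_cvg0 : (m n.+1 - m n) / m n @[n --> \oo] --> 0.
Proof.
rewrite -(mulr0 d); apply: cvgM => //.
by apply/gtr0_cvgV0; [exact: nearW|exact: convex_cvgy].
Qed.

End Increments.

(** * Measures supported in the unit interval *)

Section SupportIn01.
Variables (R : realType) (nu : {finite_measure set (measurableTypeR R) -> \bar R}).

(** Every point outside the support has a null neighbourhood, and countably many
    balls with rational centre and radius are enough to find one inside each. *)
Lemma negligible_setC_msupp : nu.-negligible (~` msupp nu).
Proof.
(* The null rational balls are enumerated through the countability of
   pairs of rationals; all other indices contribute the empty set. *)
pose null_ball (q : rat * rat) := ball (ratr q.1 : R) (ratr q.2).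
pose cover n : set (measurableTypeR R) := if @unpickle (rat * rat)%type n is Some q
  then (if nu (null_ball q) == 0%E then null_ball q else set0) else set0.
have mball (q : rat * rat) : measurable (null_ball q : set (measurableTypeR R)).
  by apply: measurable_ball.
have [A [mA A0 coverA]] : nu.-negligible (\bigcup_n cover n).
  apply: negligible_bigcup => n; rewrite /cover.
  case: unpickle => [q|]; last exact: negligible_set0.
  case: ifPn => [/eqP q0|_]; last exact: negligible_set0.
  by exists (null_ball q); split.
exists A; split=> //; apply: subset_trans coverA.
move=> x /= /existsNP[U /not_implyP[oU /not_implyP[Ux /negP]]].
rewrite -leNgt => nuU0.
have [c [r /= [xcr crU]]] := open_subball_rat oU (mem_set Ux).
have [n n_cr] : exists n, @unpickle (rat * rat)%type n = Some (c, r).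
  by exists (pickle (c, r)); rewrite pickleK.
exists n; first exact: I.
rewrite /cover n_cr ifT; first exact: set_mem.
rewrite eq_le measure_ge0 andbT (le_trans _ nuU0)// le_measure// ?inE//.
by have := open_measurable oU.
Qed.

Lemma measurable_inv_1B : measurable_fun [set: measurableTypeR R] (fun x : R => (1 - x)^-1).
Proof.
rewrite -(setvU [set (1 : R)]).
apply/measurable_funU => //; first exact: measurableC.
split; last exact: measurable_fun_set1.
apply: open_continuous_measurable_fun.
  by rewrite openC; apply/accessible_closed_set1/hausdorff_accessible/Rhausdorff.
move=> x /=.
rewrite inE /= => /eqP x1; apply: cvgV; first by rewrite subr_eq0 eq_sym.
by apply: cvgB; [exact: cvg_cst|exact: cvg_id].
Qed.

Hypothesis nu1 : nu [set 1] = 0%E.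
Hypothesis supp_le1 : (ereal_sup (EFin @` msupp nu) <= 1)%E.

Lemma measure_ge1 : nu `[1%R, +oo[%classic = 0%E.
Proof.
apply: measure_negligible; first exact: measurable_itv.
rewrite -(@setU1itv _ _ +oo%O 1 false)//; apply: negligibleU.
  by exists [set 1]; split.
apply: negligibleS negligible_setC_msupp => x /=.
rewrite in_itv/= andbT => x1 xsupp.
have /ereal_sup_ubound/le_trans/(_ supp_le1) : (EFin @` msupp nu) x%:E by exists x.
by rewrite lee_fin leNgt x1.
Qed.

Lemma integral_Rplus (f : R -> R) : measurable_fun [set: measurableTypeR R] f ->
  (\int[nu]_(x in Rplus) (f x)%:E = \int[nu]_(x in `[0%R, 1%R[) (f x)%:E)%E.
Proof.
move=> mf; have mEf : measurable_fun [set: measurableTypeR R] (EFin \o f).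
  exact/measurable_EFinP.
have -> : (@Rplus R) = `[0, 1[ `|` `[1, +oo[.
  rewrite /Rplus; apply/seteqP; split => x /=; rewrite !in_itv /= andbT.
    by move=> ->; case: ltP; [left|right].
  by case=> [/andP[]//|/(le_trans ler01)].
rewrite integral_setU//; last 2 first.
- exact: measurable_funTS mEf.
- by apply/disj_setPS => x /=; rewrite !in_itv/= andbT => -[/andP[_]]; rewrite ltNge => /negP.
rewrite [X in (_ + X)%E]null_set_integral ?adde0//; last exact: measure_ge1.
exact: measurable_funTS mEf.
Qed.

(** Made for sums of powers of x, which are largest at the right end point. *)
Lemma integrable_itv01 (g : R -> R) : continuous g ->
  (forall x, 0 <= x < 1 -> 0 <= g x <= g 1) ->
  nu.-integrable `[0%R, 1%R[ (EFin \o g).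
Proof.
move=> cg g01; apply: measurable_bounded_integrable => //.
- by rewrite ltey_eq fin_num_measure.
- by apply: measurable_funTS; exact: continuous_measurable_fun.
- exists (g 1); split; first exact: num_real.
  move=> M gM x /=; rewrite in_itv/= => /g01/andP[g0 gx1].
  by rewrite ger0_norm// (le_trans gx1)// ltW.
Qed.

End SupportIn01.

(** * The polynomials Q_n and their integrals *)

Section Qpoly.
Variable R : realType.

Lemma QpolyS n (x : R) : Qpoly n.+1 x = Qpoly n x + \sum_(j < n) x ^+ j.
Proof.
rewrite /Qpoly /=; case: n => [|n]; first by rewrite !big_ord0 addr0.
rewrite /= 2!big_ord_recr/= addrA subSn// subnn mul1r; congr (_ + _).
rewrite -big_split/=; apply: eq_bigr => j _.
by rewrite !subSS subSn 1?ltnW// -natr1 mulrDl mul1r.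
Qed.

Lemma geom_sum_ge0 n (x : R) : 0 <= x -> 0 <= \sum_(j < n) x ^+ j.
Proof. by move=> x0; apply: sumr_ge0 => j _; exact: exprn_ge0. Qed.

Lemma Qpoly_ge0 n (x : R) : 0 <= x -> 0 <= Qpoly n x.
Proof. by move=> x0; apply: sumr_ge0 => j _; rewrite mulr_ge0// exprn_ge0. Qed.

Lemma Qpoly_continuous n : continuous (@Qpoly R n).
Proof.
move=> x; rewrite /Qpoly; apply: cvg_big => [|j _]; first exact: add_continuous.
by apply: cvgM; [exact: cvg_cst|exact: exprn_continuous].
Qed.

End Qpoly.

Section GeomIntegral.
Variables (R : realType) (nu : {finite_measure set (measurableTypeR R) -> \bar R}).
Hypothesis nu1 : nu [set 1] = 0%E.
Hypothesis supp_le1 : (ereal_sup (EFin @` msupp nu) <= 1)%E.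
Local Notation geom n := (fun x : R => \sum_(j < n) x ^+ j).
Local Notation I01 := (`[0%R, 1%R[%classic : set (measurableTypeR R)).

Lemma geom_sum_continuous n : continuous (geom n).
Proof.
move=> x; apply: cvg_big => [|j _]; first exact: add_continuous.
exact: exprn_continuous.
Qed.

Lemma geom_sum_integrable n : nu.-integrable I01 (EFin \o geom n).
Proof.
apply: integrable_itv01 => [|x /andP[x0 /ltW x1]]; first exact: geom_sum_continuous.
rewrite geom_sum_ge0//= ler_sum// => j _.
by rewrite expr1n exprn_ile1.
Qed.

Lemma Qpoly_integrable n : nu.-integrable I01 (EFin \o Qpoly n).
Proof.
apply: integrable_itv01 => [|x /andP[x0 /ltW x1]]; first exact: Qpoly_continuous.
rewrite Qpoly_ge0//= ler_sum// => j _.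
by rewrite ler_wpM2l// expr1n exprn_ile1.
Qed.

Lemma Rintegral_QpolyS n : \int[nu]_(x in Rplus) Qpoly n.+1 x =
  \int[nu]_(x in Rplus) Qpoly n x + \int[nu]_(x in I01) geom n x.
Proof.
have QE k : \int[nu]_(x in Rplus) Qpoly k x = \int[nu]_(x in I01) Qpoly k x.
  rewrite /Rintegral integral_Rplus//.
  by apply: continuous_measurable_fun; exact: Qpoly_continuous.
rewrite !QE -RintegralD//; [|exact: Qpoly_integrable|exact: geom_sum_integrable].
by apply: eq_Rintegral => x _; exact: QpolyS.
Qed.

Lemma Rintegral_geom_ndecr :
  {homo (fun n => \int[nu]_(x in I01) geom n x) : k n / (k <= n)%N >-> k <= n}.
Proof.
move=> k n kn; apply: le_Rintegral => //; [exact: geom_sum_integrable..|].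
move=> x; rewrite /= in_itv/= => /andP[x0 _].
rewrite -(subnKC kn) big_split_ord/= lerDl sumr_ge0// => j _.
exact: exprn_ge0.
Qed.

(** Monotone convergence on [0, 1[, where the geometric sums increase to
    1/(1-x). The statement is about extended reals, so it also covers an
    infinite limit. *)
Lemma Rintegral_geom_cvg :
  (\int[nu]_(x in I01) geom n x)%:E @[n --> \oo] -->
    (\int[nu]_(x in Rplus) ((1 - x)^-1)%:E)%E.
Proof.
rewrite integral_Rplus//; last exact: measurable_inv_1B.
have -> : (\int[nu]_(x in I01) ((1 - x)^-1)%:E =
    \int[nu]_(x in I01) limn (fun n => (geom n x)%:E))%E.
  apply: eq_integral => x; rewrite inE /= in_itv /= => /andP[x0 x1].
  apply/esym/cvg_lim => //; apply: cvg_EFin; first exact: nearW.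
  have := @cvg_geometric_series R 1 x; rewrite mul1r ger0_norm// => /(_ x1).
  apply: cvg_trans; apply: near_eq_cvg; apply: nearW => n /=.
  by rewrite /series/= big_mkord; apply: eq_bigr => j _; rewrite /= mul1r.
have := @cvg_monotone_convergence _ _ R nu I01 _ (fun n x => (geom n x)%:E).
have mI : measurable I01 by exact: measurable_itv.
move=> /(_ mI) H.
rewrite [X in X @ _ --> _](_ : _ = (fun n => \int[nu]_(x in I01) (geom n x)%:E)%E); last first.
  apply/funext => n; rewrite /Rintegral fineK//.
  by apply: integrable_fin_num => //; exact: geom_sum_integrable.
apply: H.
- move=> n; apply/measurable_EFinP; apply: measurable_funTS; apply: continuous_measurable_fun.
  exact: geom_sum_continuous.
- by move=> n x; rewrite /= in_itv/= => /andP[x0 _]; rewrite lee_fin geom_sum_ge0.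
- move=> x; rewrite /= in_itv/= => /andP[x0 _] k n kn; rewrite lee_fin.
  rewrite -(subnKC kn) big_split_ord/= lerDl sumr_ge0// => j _.
  exact: exprn_ge0.
Qed.

End GeomIntegral.

(** * Diagonal operators with entries tending to zero *)

(** The image of an ultrafilter behaves like an ultrafilter: a cluster point in A
    is a limit point, since for each neighbourhood V of it either the preimage of
    V or that of its complement is large. *)
Lemma ultra_cvg_compact (T : Type) (U : topologicalType) (F : set_system T)
    (f : T -> U) (A : set U) : UltraFilter F -> compact A -> F (f @^-1` A) ->
  exists2 p, A p & f @ F --> p.
Proof.
move=> FU cA FA; have PF : ProperFilter F by exact: ultra_proper.
have [p [Ap clp]] := cA (f @ F) _ FA; exists p => // V Vp.
case: (in_ultra_setVsetC (f @^-1` V) FU) => // FVC.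
by have [q [/= nVq Vq]] := clp (~` V) V FVC Vp.
Qed.

Section DiagonalOperator.
Variables (R : realType) (mu : nat -> R) (B : {linear ell2 R -> ell2 R}).
Hypothesis diagB : forall x k, B x k = (mu k)%:C%C * x k.
Hypothesis mu0 : mu n @[n --> \oo] --> 0.

(** A compact set containing the image of the unit ball: the mass of the
    coordinates from N on is bounded by any bound on the squared entries from N
    on, hence is uniformly small for large N. *)
Definition tail_dominated : set (ell2 R) := [set y | forall N r,
  (forall k, (N <= k)%N -> mu k ^+ 2 <= r) ->
  forall n, \sum_(N <= k < n) normc2 (y k) <= r].

Lemma diagonal_ball_tail_dominated x : `|x| <= 1 -> tail_dominated (B x).
Proof.
move=> x1 N r mur n.
have r0 : 0 <= r by rewrite (le_trans _ (mur N (leqnn N)))// sqr_ge0.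
apply: (@le_trans _ _ (\sum_(N <= k < n) r * normc2 (x k))).
  rewrite big_nat_cond [leRHS]big_nat_cond; apply: ler_sum => k /andP[/andP[Nk _] _].
  rewrite diagB normc2M [X in X * _](_ : _ = mu k ^+ 2); last first.
    by rewrite /normc2 /= expr0n addr0.
  by rewrite ler_wpM2r ?normc2_ge0 ?mur.
rewrite -mulr_sumr ler_piMr//.
have : limn (series (fun k => normc2 (x k))) <= 1 ^+ 2.
  by rewrite -(@ell2_le_norm R x 1)//.
rewrite expr1n => /(le_trans (ell2_partial_le x n)); apply: le_trans.
have [nN|Nn] := leqP n N.
  by rewrite big_geq// sumr_ge0// => k _; exact: normc2_ge0.
rewrite -(big_mkord xpredT (fun k => normc2 (x k))) (@big_cat_nat _ _ _ N 0 n)//=; last exact: ltnW.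
by rewrite lerDr sumr_ge0// => k _; exact: normc2_ge0.
Qed.

(** Along an ultrafilter the coordinates converge, because they stay bounded; the
    uniform smallness of the tails upgrades this to convergence in norm. *)
Lemma tail_dominated_compact : compact tail_dominated.
Proof.
have [M muM] : exists M, forall k, mu k ^+ 2 <= M.
  have /cvg_seq_bounded/bounded_fun_has_ubound[M aM] : cvgn (mu * mu).
    by apply: is_cvgM; apply/cvg_ex; exists 0.
  by exists M => k; rewrite expr2; apply: aM; exists k.
rewrite compact_ultra => F FU FK; have PF : ProperFilter F by exact: ultra_proper.
have coordM y k : tail_dominated y -> normc2 (y k) <= M.
  move=> /(_ k M (fun j _ => muM j) k.+1).
  by rewrite big_nat1.
have M0 : 0 <= M by rewrite (le_trans _ (muM 0%N))// sqr_ge0.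
have coord_cvg (p : R[i] -> R) : (forall c, p c ^+ 2 <= normc2 c) ->
    forall k, cvg ((fun y : ell2 R => p (y k)) @ F).
  move=> pn k; have [||q _ pq] := @ultra_cvg_compact _ R^o F (fun y => p (y k))
      `[- Num.sqrt M, Num.sqrt M]%classic FU; last by apply/cvg_ex; exists q.
    exact: segment_compact.
  apply: filterS FK => y /coordM - /(_ k) /(le_trans (pn _)) pM.
  by rewrite /= in_itv /= -ler_norml -sqrtr_sqr ler_wsqrtr.
have cRe : forall k, cvg ((fun y : ell2 R => complex.Re (y k)) @ F).
  by apply: coord_cvg => [[a b]]; rewrite /normc2 /= lerDl sqr_ge0.
have cIm : forall k, cvg ((fun y : ell2 R => complex.Im (y k)) @ F).
  by apply: coord_cvg => [[a b]]; rewrite /normc2 /= lerDr sqr_ge0.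
pose a k : R[i] := (lim ((fun y : ell2 R => complex.Re (y k)) @ F) +i*
                 lim ((fun y : ell2 R => complex.Im (y k)) @ F))%C.
have cnorm z k : (fun y : ell2 R => normc2 (y k - z)) @ F --> normc2 (a k - z).
  have normc2B (c d : R[i]) : normc2 (c - d) =
      (complex.Re c - complex.Re d) * (complex.Re c - complex.Re d) +
      (complex.Im c - complex.Im d) * (complex.Im c - complex.Im d).
    by case: c d => [? ?] [? ?]; rewrite /normc2 /= !expr2.
  under eq_fun do rewrite normc2B.
  rewrite normc2B /a /=.
  have hRe : (fun y : ell2 R => complex.Re (y k) - complex.Re z) @ F -->
      lim ((fun y : ell2 R => complex.Re (y k)) @ F) - complex.Re z.
    by apply: cvgB; [exact: cRe|exact: cvg_cst].
  have hIm : (fun y : ell2 R => complex.Im (y k) - complex.Im z) @ F -->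
      lim ((fun y : ell2 R => complex.Im (y k)) @ F) - complex.Im z.
    by apply: cvgB; [exact: cIm|exact: cvg_cst].
  exact: cvgD (cvgM hRe hRe) (cvgM hIm hIm).
have csum (z : nat -> R[i]) N n :
    (fun y : ell2 R => \sum_(N <= k < n) normc2 (y k - z k)) @ F -->
    \sum_(N <= k < n) normc2 (a k - z k).
  by apply: cvg_big => [|i _]; [exact: add_continuous|exact: cnorm].
have a_tail N r : (forall k, (N <= k)%N -> mu k ^+ 2 <= r) ->
    forall n, \sum_(N <= k < n) normc2 (a k) <= r.
  move=> mur n; have := csum 0 N n.
  under eq_fun do under eq_bigr do rewrite subr0.
  under [X in _ --> X]eq_bigr do rewrite subr0.
  move=> ca; rewrite -(cvg_lim _ ca)//; apply: limr_le; first exact: cvgP ca.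
  by apply: filterS FK => y /(_ N r mur n).
have a_ss : square_summable a.
  apply/nneg_series_bounded => [k|]; first exact: normc2_ge0.
  by exists M => n; rewrite -(big_mkord xpredT (fun k => normc2 (a k))) a_tail.
exists (Ell2 (asboolT a_ss)); split=> //.
apply/cvgrPdist_le => e e0.
have [r r0 ->] : exists2 r : R, 0 < r & e = r%:C%C.
  by case: e e0 => s t; rewrite ltcE /= => /andP[/eqP -> s0]; exists s.
(* The squared distance to the limit is at most d for the first N coordinates
   and 2 d + 2 d for the tails, in total 5 d < r ^+ 2. *)
pose d := r ^+ 2 / 8; have d0 : 0 < d by rewrite divr_gt0// exprn_gt0.
have [N muN] : exists N, forall k, (N <= k)%N -> mu k ^+ 2 <= d.
  have : mu n * mu n @[n --> \oo] --> 0 by rewrite -(mulr0 0); apply: cvgM.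
  by move=> /cvgr_le/(_ d d0)[N _ muN]; exists N => k /muN; rewrite expr2.
have := csum a 0%N N.
rewrite [X in _ --> X]big1; last by move=> k _; rewrite subrr /normc2/= expr0n addr0.
move=> /cvgr_le/(_ d d0) Fd.
apply: filterS2 FK Fd => y Ky yd; rewrite distrC (ell2_le_norm _ (ltW r0)).
apply: limr_le; first exact: (@ell2P R (y - Ell2 (asboolT a_ss))).
near=> n; rewrite /series /= (@big_cat_nat _ _ _ N 0 n)//=; last by near: n; exists N.
have tail : \sum_(N <= k < n) normc2 (y k - a k) <= 2 * d + 2 * d.
  apply: (@le_trans _ _ (\sum_(N <= k < n) (2 * normc2 (y k) + 2 * normc2 (a k)))).
    apply: ler_sum => k _; rewrite (le_trans (normc2D _ _))// lerD2l.
    by case: (a k) => s t; rewrite /normc2/= !sqrrN.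
  rewrite big_split/= -!mulr_sumr lerD// ler_wpM2l//; [exact: Ky|exact: a_tail].
apply: (@le_trans _ _ (d + (2 * d + 2 * d))); first exact: lerD.
by rewrite /d; have := sqr_ge0 r; lra.
Unshelve. all: by end_near. Qed.

Lemma diagonal_compact : compact_operator B.
Proof.
rewrite /compact_operator.
exists tail_dominated; first by move=> _ [x /= x1 <-]; exact: diagonal_ball_tail_dominated.
split; first exact: tail_dominated_compact.
by apply: compact_closed tail_dominated_compact; exact: norm_hausdorff.
Qed.

End DiagonalOperator.

(** * Positive forms and subnormal operators *)

Section HilbertLemmas.
Variables (R : realType) (H : hilbertType R).
Implicit Types (x y : H) (T S : {linear H -> H}).

Lemma innerC x y : inner x y = (inner y x)^*.
Proof. by rewrite hermC expr0 mul1r. Qed.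

Lemma is_adjoint_sym T S : is_adjoint T S -> is_adjoint S T.
Proof. by move=> TS x y; rewrite innerC -TS -innerC. Qed.

Lemma is_adjoint_iter T S n x y :
  is_adjoint T S -> inner (iter n S x) y = inner x (iter n T y).
Proof.
move=> /is_adjoint_sym ST; elim: n x y => //= n IHn x y.
by rewrite ST IHn -iterSr.
Qed.

(** The equality case of the Cauchy-Schwarz inequality for the positive form of D,
    with a map D that is linear only through its symmetry. The form at
    D x - s x is q - 2 s <D x, D x> with q = <D D x, D x>; if D x were nonzero,
    it would be negative for large s. *)
Lemma positive_form_kernel (D : H -> H) :
  (forall x y, inner (D x) y = inner x (D y)) ->
  (forall x, 0 <= inner (D x) x) ->
  forall x, inner (D x) x = 0 -> D x = 0.
Proof.
move=> Dsym D0 x Dx0; apply/eqP; rewrite -(dnorm_eq0 inner); apply/eqP.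
set y := D x; set n := inner y y; set q := inner (D y) y.
have n0 : 0 <= n by exact: dnorm_ge0.
have q0 : 0 <= q by exact: D0.
have ineq (s : R[i]) : 0 <= s -> 0 <= q - 2 * s * n.
  move=> s0; have sE : s^* = s by apply/CrealP/ger0_real.
  have := D0 (y - s *: x); rewrite Dsym.
  have -> : inner (y - s *: x) (D (y - s *: x)) =
      inner (D y) y - s * inner (D x) y - s * inner (D y) x + s * s * inner (D x) x.
    rewrite -Dsym linearBr/= linearZr_LR/= sE !(Dsym (y - _)) !linearBl/= !linearZl_LR/= -!Dsym.
    by rewrite -[s *: _]/(s * _) mulrBr opprD opprK !addrA.
  by rewrite Dx0 (Dsym y x) -/y -/n -/q mulr0 addr0 -addrA -opprD -mulr2n -mulrA mulr_natl.
have [//|nN0] := eqVneq n 0.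
have n_gt0 : 0 < n by rewrite lt_neqAle eq_sym nN0.
(* With this value of s the form equals q - 2 (q + 1) = - (q + 2). *)
have := ineq ((q + 1) / n) (divr_ge0 (addr_ge0 q0 ler01) n0).
rewrite -mulrA divfK// mulr_natl [X in _ <= X](_ : _ = - (q + 2)); last first.
  by rewrite mulr2n opprD addrA [- (q + 1) in X in X + _]opprD addrA subrr add0r -opprD addrCA.
by rewrite oppr_ge0 => /(lt_le_trans (ltr_wpDl q0 (ltr0Sn _ 1))); rewrite ltxx.
Qed.

End HilbertLemmas.

(** For the normal extension N and v = V x, Cauchy-Schwarz applied to
    ||N v||^2 = <v, N^* N v> gives the bound ||v|| ||N^* N v||, and normality
    turns ||N^* (N v)|| into ||N (N v)||. *)
Lemma subnormal_norm_le (R : realType) (H : hilbertType R) (T : {linear H -> H}) :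
  subnormal T -> forall x,
  inner (T x) (T x) ^+ 2 <= inner x x * inner (T (T x)) (T (T x)).
Proof.
move=> [K [V [N [Viso [_ [S NS comm]] NV]]]] x.
have SN := is_adjoint_sym NS.
rewrite -!Viso -!NV; set v := V x.
have -> : inner (N (N v)) (N (N v)) = inner (S (N v)) (S (N v)).
  by rewrite SN comm -NS.
rewrite -[leLHS]ger0_norm ?exprn_ge0 ?dnorm_ge0// normrX NS.
exact: dot_CauchySchwarz.
Qed.

(** * Weighted shifts on the standard basis *)

Section Ell2Basis.
Variable R : realType.
Local Notation e := (ell2_basis R).

Lemma inner_basis (x : ell2 R) k : inner x (e k) = x k.
Proof.
rewrite -[inner _ _]/(ell2_dot x (e k)) /ell2_dot /csum.
have lim_single (u : R ^nat) : (forall j, j != k -> u j = 0) ->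
    limn (series u) = u k.
  move=> u0; apply: cvg_lim => //; apply: cvg_near_cst; exists k.+1 => // n /= kn.
  rewrite /series/= big_mkord (bigD1 (Ordinal kn))//= big1 ?addr0//.
  by move=> j; rewrite -val_eqE /= => /u0.
rewrite !lim_single => [|j /negPf jk|j /negPf jk].
- by rewrite /= eqxx conjC1 mulr1; case: (x k).
- by rewrite /= jk conjC0 mulr0.
- by rewrite /= jk conjC0 mulr0.
Qed.

Lemma inner_basis_sq k : inner (e k) (e k) = 1.
Proof. by rewrite inner_basis /= eqxx. Qed.

Variables (lam : nat -> R) (lam_bnd : bounded_fun lam).
Local Notation W := (wshift lam_bnd).

Lemma iter_wshift_basis n k :
  iter n W (e k) = (\prod_(j < n) lam (k + j)%N)%:C%C *: e (k + n)%N.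
Proof.
elim: n => [|n IHn]; first by rewrite big_ord0 addn0 /= scale1r.
rewrite iterS IHn linearZ/= wshift_basis scalerA -rmorphM big_ord_recr/= addnS.
by [].
Qed.

Lemma inner_iter_wshift_basis n k :
  inner (iter n W (e k)) (iter n W (e k)) = (\prod_(j < n) lam (k + j)%N ^+ 2)%:C%C.
Proof.
rewrite iter_wshift_basis dnormZ inner_basis_sq mulr1.
by rewrite -normc2E /normc2/= expr0n addr0 prodrXl.
Qed.

Lemma adjoint_wshift (Wadj : {linear ell2 R -> ell2 R}) (x : ell2 R) k :
  is_adjoint W Wadj -> Wadj (W x) k = (lam k ^+ 2)%:C%C * x k.
Proof.
move=> adj; rewrite -inner_basis (is_adjoint_sym adj) /= wshift_basis.
rewrite linearZr_LR/= inner_basis /= [X in X * _](conjc_real (lam k)) mulrA.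
by rewrite -rmorphM -expr2.
Qed.

End Ell2Basis.

(** * The representing triplet of a weighted shift *)

Lemma quadratic_le_linear (R : realType) (g p q : R) :
  (forall n : nat, g * n%:R ^+ 2 <= p + q * n%:R) -> g <= 0.
Proof.
move=> gle; rewrite leNgt; apply/negP => g0.
have A0 : 0 <= (`|p| + `|q|) / g by rewrite divr_ge0 ?addr_ge0// ltW.
have := archi_boundP A0; set n := Num.bound _ => An.
have := gle n.
have n1 : 1 <= n%:R :> R.
  by rewrite ler1n lt0n; apply: contraTneq An => ->; rewrite -leNgt.
move: An; rewrite ltr_pdivrMr// => An.
have h1 : p <= `|p| * n%:R by rewrite (le_trans (ler_norm p))// ler_peMr.
have h2 : q * n%:R <= `|q| * n%:R by rewrite ler_wpM2r// ler_norm.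
have h3 : (`|p| + `|q|) * n%:R < n%:R * g * n%:R by rewrite ltr_pM2r// (lt_le_trans ltr01).
have -> : g * n%:R ^+ 2 = n%:R * g * n%:R by ring.
rewrite mulrDl in h3; lra.
Qed.

Section WeightedShift.
Variables (R : realType) (lam : nat -> R) (lam_bnd : bounded_fun lam).
Hypothesis lam_gt0 : forall n, 0 < lam n.
Local Notation W := (wshift lam_bnd).
Local Notation e := (ell2_basis R).
Local Notation m n := (\prod_(k < n) lam k ^+ 2).

Lemma moment_gt0 n : 0 < m n.
Proof. by apply: prodr_gt0 => k _; rewrite exprn_gt0. Qed.

(** The bound for subnormal operators at e_n reads
    lam_n^4 <= lam_n^2 lam_(n+1)^2. *)
Lemma subnormal_wshift_ndecr : subnormal W ->
  {homo (fun n => lam n ^+ 2) : k n / (k <= n)%N >-> k <= n}.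
Proof.
move=> /subnormal_norm_le Wle; apply: homo_leq => [//|? ? ?|n]; first exact: le_trans.
have := Wle (e n); rewrite (inner_iter_wshift_basis lam_bnd 1) (inner_iter_wshift_basis lam_bnd 2).
rewrite inner_basis_sq mul1r -rmorphXn /= lecR big_ord1 !big_ord_recr big_ord0 /= mul1r addn0 addn1.
by rewrite expr2 ler_pM2l// exprn_gt0.
Qed.

Variables (B C : {linear ell2 R -> ell2 R}) (F : set R -> {linear ell2 R -> ell2 R}).
Hypothesis tripletE : representing_triplet W B C F.

(** If the moments grow at most linearly, the quadratic term of the triplet
    vanishes on every basis vector. The operator W^* W - I - B is C up to the
    integral of Qpoly 1 = 0, but it is visibly self-adjoint, which lets its
    vanishing on the basis propagate to all vectors. *)
Lemma linear_growth_diagonal a q : (forall n, m n <= a + q * n%:R) ->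
  forall x k, B x k = (lam k ^+ 2 - 1)%:C%C * x k.
Proof.
move=> mle; case: tripletE => [[_ Bsym] [_ Cpos] [_ Fmu] _ _ _ [Wadj adj reprE]].
pose D x := Wadj (W x) - x - B x.
have DE x : inner (D x) x = inner (C x) x.
  have [S [_ SE /(_ x) /= WE]] := reprE 1%N; have [mu mux] := Fmu x.
  have := SE x mu mux.
  rewrite (_ : Qpoly 1 = cst 0); last by apply/funext => y; rewrite /Qpoly big_ord0.
  rewrite /Rintegral integral0 => S0.
  have -> : D x = C x + S x.
    by rewrite /D WE !mulr1n -[x + _ + _ + _]addrA [x + _ + _]addrC [x + _]addrC addrA !addrK.
  by rewrite linearDl/= S0 addr0.
have Dsym x y : inner (D x) y = inner x (D y).
  rewrite /D !linearBl/= !linearBr/= Bsym.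
  by rewrite (is_adjoint_sym adj) adj.
have D0 x : 0 <= inner (D x) x by rewrite DE; exact: Cpos.
have De k : D (e k) = 0.
  apply: (positive_form_kernel Dsym D0); rewrite DE.
  (* positivity in R[i] contains reality, so the form of C is a real number g *)
  pose g := complex.Re (inner (C (e k)) (e k)).
  have gE : inner (C (e k)) (e k) = g%:C%C.
    have := Cpos (e k); rewrite /g; case: (inner _ _) => s t.
    by rewrite lecE /= => /andP[/eqP -> _].
  have g0 : 0 <= g by have := Cpos (e k); rewrite gE ler0c.
  suff : g <= 0 by move=> gle0; rewrite gE (le_anti (introT andP (conj gle0 g0))).
  pose bk := complex.Re (inner (B (e k)) (e k)).
  apply: (@quadratic_le_linear _ g ((a + q * k%:R) / m k - 1) (q / m k - bk)) => n.
  have [S [_ SE WE]] := reprE n; have [mu muk] := Fmu (e k).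
  have PE : inner (iter n Wadj (iter n W (e k))) (e k) =
      (\prod_(j < n) lam (k + j)%N ^+ 2)%:C%C.
    rewrite (is_adjoint_iter n _ _ adj).
    exact: inner_iter_wshift_basis.
  rewrite WE in PE.
  rewrite -(scaler_nat n (B (e k))) -(scaler_nat _ (C (e k))) in PE.
  rewrite !linearDl/= !linearZl_LR/= in PE.
  rewrite inner_basis_sq gE (SE _ _ muk) in PE.
  move/(congr1 (@complex.Re R)): PE.
  have s0 : 0 <= \int[mu]_(x in Rplus) Qpoly n x.
    by apply: Rintegral_ge0 => x x0; exact: Qpoly_ge0.
  have := mle (k + n)%N; rewrite big_split_ord/= -ler_pdivlMl ?moment_gt0//.
  have ReE (z : R[i]) (s : R) : complex.Re (1 + n%:R * z + (n ^ 2)%:R * g%:C%C + s%:C%C) =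
      1 + n%:R * complex.Re z + n%:R ^+ 2 * g + s.
    rewrite -!(rmorph_nat (@real_complex R)) natrX.
    by case: z => u v /=; rewrite !mul0r !subr0.
  rewrite ReE -/bk.
  rewrite natrD => leP PE.
  have : (m k)^-1 * (a + q * (k%:R + n%:R)) = (a + q * k%:R) / m k + q / m k * n%:R by ring.
  lra.
move=> x k.
have : D x k = 0 by rewrite -inner_basis Dsym De linear0r.
rewrite -[D x k]/(Wadj (W x) k - x k - B x k) (adjoint_wshift _ _ adj) => /subr0_eq <-.
by rewrite rmorphB /= mulrBl mul1r.
Qed.

End WeightedShift.

Theorem proposition6p2 (R : realType) (lam : nat -> R)
  (lam_gt0 : forall n, 0 < lam n) (lam_bnd : bounded_fun lam)
  (lam_cpd : cpd_operator (wshift lam_bnd))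
  (b c : R) (nu : {finite_measure set (measurableTypeR R) -> \bar R})
  (scalarE : scalar_triplet lam b c nu)
  (B C : {linear ell2 R -> ell2 R}) (F : set R -> {linear ell2 R -> ell2 R})
  (tripletE : representing_triplet (wshift lam_bnd) B C F)
  (supp_le1 : (ereal_sup (EFin @` msupp nu) <= 1)%E)
  (c0 : c = 0)
  (int_fin : (\int[nu]_(x in Rplus) ((1 - x)^-1)%:E < +oo)%E)
  (int_neq0 : (b%:E + \int[nu]_(x in Rplus) ((1 - x)^-1)%:E <> 0)%E) :
  compact_operator B /\ ~ subnormal (wshift lam_bnd).
Proof.
have nu1 := scalar_1 scalarE.
set J := (\int[nu]_(x in Rplus) _)%E in int_fin int_neq0.
have JE : J = (fine J)%:E.
  rewrite fineK// ge0_fin_numE// /J integral_Rplus//; last exact: measurable_inv_1B.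
  apply: integral_ge0 => x; rewrite /= in_itv/= => /andP[_ x1].
  by rewrite lee_fin invr_ge0 subr_ge0 ltW.
pose m n := \prod_(k < n) lam k ^+ 2; pose d := b + fine J.
have m_gt0 n : 0 < m n by exact: moment_gt0.
have dmE n : m n.+1 - m n = b + \int[nu]_(x in `[0, 1[) (\sum_(j < n) x ^+ j).
  rewrite /m !(scalar_repr scalarE) c0 !mul0r !addr0 Rintegral_QpolyS// -natr1 mulrDr mulr1.
  lra.
have dm_ndecr : {homo (fun n => m n.+1 - m n) : k n / (k <= n)%N >-> k <= n}.
  by move=> k n kn; rewrite !dmE lerD2l; exact: Rintegral_geom_ndecr.
have dm_cvg : m n.+1 - m n @[n --> \oo] --> d.
  under eq_fun do rewrite dmE.
  apply: cvgD; first exact: cvg_cst.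
  have := Rintegral_geom_cvg nu1 supp_le1.
  by rewrite -/J JE => /fine_cvg.
have d0 : d != 0.
  by apply/eqP => d0; apply: int_neq0; rewrite JE -EFinD -/d d0.
have mE n : lam n ^+ 2 - 1 = (m n.+1 - m n) / m n.
  have mn0 : m n != 0 by rewrite gt_eqF.
  have -> : m n.+1 = m n * lam n ^+ 2 by rewrite /m big_ord_recr.
  by rewrite mulrBl (divff mn0) mulrAC (divff mn0) mul1r.
have lam_cvg : lam n ^+ 2 - 1 @[n --> \oo] --> 0.
  by under eq_fun do rewrite mE; exact: (convex_ratio_cvg0 m_gt0 dm_ndecr dm_cvg d0).
split.
  apply: (diagonal_compact _ lam_cvg).
  exact: (linear_growth_diagonal lam_gt0 tripletE (convex_le_chord dm_ndecr dm_cvg)).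
(* A nondecreasing sequence lies below its limit, here lam n ^+ 2 - 1 <= 0,
   so no increment of m is positive. *)
move=> /(subnormal_wshift_ndecr lam_gt0) lam_ndecr.
have := lim_increment_gt0 m_gt0 dm_ndecr dm_cvg d0.
apply/negP; rewrite -leNgt -(cvg_lim _ dm_cvg)//.
apply: limr_le; first exact: cvgP dm_cvg.
apply: nearW => n; have : 0 < (m n)^-1 by rewrite invr_gt0.
move=> /pmulr_lle0 <-; rewrite -mE.
rewrite -(cvg_lim _ lam_cvg)//.
apply: (nondecreasing_cvgn_le _ (cvgP _ lam_cvg)) => i j ij.
by rewrite lerD2r lam_ndecr.
Qed.
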